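(* Let $\mathcal{G}=([n],\mathcal{E},\mathcal{A})$, $n\ge2$, be a strongly connected, weight balanced directed weighted graph with loop-less Laplacian $\mathcal{L}$. Then for all distinct $a,b\in[n]$, the effective resistance from $a$ to $b$ satisfies $$R_{\mathcal{G}}(a,b)=(e_a-e_b)^\top\mathcal{L}^\dagger(e_a-e_b)=(e_a-e_b)^\top\mathcal{L}_s^\dagger(e_a-e_b),$$ where $\mathcal{L}^\dagger$ is the Moore–Penrose pseudoinverse of $\mathcal{L}$, $\mathcal{L}_s^\dagger=(\mathcal{L}^\dagger+(\mathcal{L}^\dagger)^\top)/2$, and $e_a$ denotes the $a$-th standard basis vector of $\mathbb{R}^n$.
   Context: A directed weighted graph $\mathcal{G}=([n],\mathcal{E},\mathcal{A})$ has node set $[n]$ and weighted adjacency matrix $\mathcal{A}\in\mathbb{R}^{n\times n}$ with nonnegative entries; for $i\neq j$, $\mathcal{A}_{ij}>0$ means an edge from $i$ to $j$. It is strongly connected if there is a directed path from every node to every other node, and weight balanced if $\sum_j\mathcal{A}_{ij}=\sum_j\mathcal{A}_{ji}$ for every $i$. The degree matrix is $\mathcal{D}=\mathrm{diag}(\sum_j\mathcal{A}_{ij})_i$ and the loop-less Laplacian is $\mathcal{L}=\mathcal{D}-\mathcal{A}$. For $\beta\subseteq[n]$, $\beta^c=[n]\setminus\beta$, $M[\beta,\gamma]$ is the submatrix with rows in $\beta$ and columns in $\gamma$, and $M/M[\beta^c,\beta^c]=M[\beta,\beta]-M[\beta,\beta^c]M[\beta^c,\beta^c]^{-1}M[\beta^c,\beta]$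 (with $M/M[\emptyset,\emptyset]=M$). For distinct $a,b$, the effective conductance from $a$ to $b$ is $C_{\mathcal{G}}(a,b)=(\mathcal{L}/\mathcal{L}[\{a,b\}^c,\{a,b\}^c])_{aa}$ and the effective resistance is $R_{\mathcal{G}}(a,b)=1/C_{\mathcal{G}}(a,b)$. *)

(* Defs.v *)
From HB Require Import structures.
From mathcomp Require Import all_boot all_order all_algebra.
From mathcomp Require Import boolp classical_sets reals.

Set Implicit Arguments.
Unset Strict Implicit.
Unset Printing Implicit Defensive.

Import Order.TTheory GRing.Theory Num.Theory.
Local Open Scope ring_scope.

(* The edge set is determined by the adjacency matrix, so it is not a field;
   diagonal entries (self-loops) are allowed. *)
Record wdigraph (R : realType) (n : nat) := WDigraph {
  adj : 'M[R]_n;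
  adj_ge0 : forall i j, 0 <= adj i j
}.

Section Graph.
Variables (R : realType) (n : nat).
Implicit Types (G : wdigraph R n).

Definition edge G : rel 'I_n := [rel i j | (i != j) && (0 < adj G i j)].

Definition strongly_connected G : Prop :=
  forall i j : 'I_n, i != j -> connect (edge G) i j.

Definition weight_balanced G : Prop :=
  forall i : 'I_n, \sum_j adj G i j = \sum_j adj G j i.

Definition degree_mx G : 'M[R]_n := diag_mx (\row_i \sum_j adj G i j).

Definition laplacian G : 'M[R]_n := degree_mx G - adj G.

(* Rows (resp. columns) are enumerated in the order of [enum beta]
   (resp. [enum gamma]), i.e., in increasing order. *)
Definition set_submx (M : 'M[R]_n) (beta gamma : {set 'I_n}) :
    'M[R]_(#|beta|, #|gamma|) :=
  \matrix_(i, j) M (enum_val i) (enum_val j).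

(* M / M[beta^c, beta^c] *)
Definition schur (M : 'M[R]_n) (beta : {set 'I_n}) : 'M[R]_#|beta| :=
  set_submx M beta beta
  - set_submx M beta (~: beta)
    *m invmx (set_submx M (~: beta) (~: beta))
    *m set_submx M (~: beta) beta.

(* [enum_rank_in (set21 a b) a] is the position of a in {a, b}. *)
Definition eff_conductance G (a b : 'I_n) : R :=
  let ia := enum_rank_in (set21 a b) a in
  schur (laplacian G) [set a; b] ia ia.

Definition eff_resistance G (a b : 'I_n) : R := 1 / eff_conductance G a b.

End Graph.

Section MoorePenrose.
Variables (R : realType).

Definition penrose (m n : nat) (A : 'M[R]_(m, n)) (X : 'M[R]_(n, m)) : Prop :=
  [/\ A *m X *m A = A,
      X *m A *m X = X,
      (A *m X)^T = A *m X &
      (X *m A)^T = X *m A].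

Definition pinv (m n : nat) (A : 'M[R]_(m, n)) : 'M[R]_(n, m) :=
  xget 0 [set X | penrose A X]%classic.

Lemma mulmx_tr_eq0 (n : nat) (u : 'rV[R]_n) : u *m u^T = 0 -> u = 0.
Proof.
move=> /matrixP /(_ 0 0); rewrite !mxE => u0.
apply/rowP => j; rewrite mxE; apply/eqP; rewrite -sqrf_eq0; apply/eqP.
have /psumr_eq0P : \sum_i u 0 i ^+ 2 = 0.
  by rewrite -[RHS]u0; apply: eq_bigr => i _; rewrite mxE expr2.
by apply=> // i _; apply: sqr_ge0.
Qed.

Lemma row_free_gram (r n : nat) (C : 'M[R]_(r, n)) :
  row_free C -> C *m C^T \in unitmx.
Proof.
move=> freeC; rewrite -row_free_unit; apply/inj_row_free => v vCC.
have : v *m C = 0.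
  by apply: mulmx_tr_eq0; rewrite trmx_mul mulmxA -[v *m C *m C^T]mulmxA vCC mul0mx.
by move=> vC; apply: (row_free_inj freeC); rewrite vC mul0mx.
Qed.

Lemma penrose_ex (m n : nat) (A : 'M[R]_(m, n)) : exists X, penrose A X.
Proof.
have [r [B [C [defA freeC freeB]]]] : exists r (B : 'M[R]_(m, r))
    (C : 'M[R]_(r, n)), [/\ A = B *m C, row_free C & row_free B^T].
  exists (\rank A), (col_base A), (row_base A).
  rewrite mulmx_base row_base_free /row_free mxrank_tr; split=> //.
  exact: col_base_full.
have uC : C *m C^T \in unitmx by apply: row_free_gram.
have uB : B^T *m B \in unitmx by rewrite -{2}[B]trmxK; apply: row_free_gram.
pose P := invmx (C *m C^T); pose Q := invmx (B^T *m B).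
have trP : P^T = P by rewrite trmx_inv trmx_mul trmxK.
have trQ : Q^T = Q by rewrite trmx_inv trmx_mul trmxK.
pose X := C^T *m P *m Q *m B^T.
have AX : A *m X = B *m Q *m B^T.
  rewrite defA /X !mulmxA -[B *m C *m C^T]mulmxA -[_ *m P]mulmxA mulmxV //.
  by rewrite mulmx1.
have XA : X *m A = C^T *m P *m C.
  rewrite defA /X !mulmxA -[_ *m B^T *m B]mulmxA -[_ *m Q *m _]mulmxA mulVmx //.
  by rewrite mulmx1.
exists X; split.
- rewrite AX {1}defA mulmxA -[_ *m B^T *m B]mulmxA -[_ *m Q *m _]mulmxA mulVmx //.
  by rewrite mulmx1 -defA.
- rewrite XA /X !mulmxA -[_ *m C *m C^T]mulmxA -[_ *m P *m (C *m _)]mulmxA.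
  by rewrite mulVmx // mulmx1.
- by rewrite AX !trmx_mul trmxK trQ mulmxA.
- by rewrite XA !trmx_mul trmxK trP mulmxA.
Qed.

Lemma penrose_uniq (m n : nat) (A : 'M[R]_(m, n)) X Y :
  penrose A X -> penrose A Y -> X = Y.
Proof.
move=> [AXA XAX trAX trXA] [AYA YAY trAY trYA].
have eqA : A *m X = A *m Y.
  by rewrite -trAX -{1}AYA -mulmxA trmx_mul trAX trAY mulmxA AXA.
have eqX : X *m A = Y *m A.
  by rewrite -trXA -{1}AYA -mulmxA mulmxA trmx_mul trXA trYA -mulmxA [A *m _]mulmxA AXA.
by rewrite -XAX -mulmxA eqA mulmxA eqX YAY.
Qed.

Lemma pinvP (m n : nat) (A : 'M[R]_(m, n)) : penrose A (pinv A).
Proof. by have [X AX] := penrose_ex A; apply: (xgetPex 0 (ex_intro _ X AX)). Qed.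

Definition sym_part (n : nat) (M : 'M[R]_n) : 'M[R]_n := 2^-1 *: (M + M^T).

Definition basis_vec (n : nat) (a : 'I_n) : 'cV[R]_n := delta_mx a 0.

End MoorePenrose.

Arguments basis_vec R [n] a.

(* Main.v *)
Require Import Defs.
From HB Require Import structures.
From mathcomp Require Import all_boot all_order all_algebra.
From mathcomp Require Import reals ring.

Set Implicit Arguments.
Unset Strict Implicit.
Unset Printing Implicit Defensive.

Import Order.TTheory GRing.Theory Num.Theory.
Local Open Scope ring_scope.

(** The quadratic form of the Laplacian of a balanced graph is
    [1/2 * \sum_(i, j) A_ij (u_i - u_j)^2], so on a strongly connected graph it
    vanishes only at constant vectors.  Hence the principal submatrix off
    [{a, b}] is invertible, and [v := L^+ (e_a - e_b)] solves
    [L v = e_a - e_b].  Since [L] kills constants, [w := v - v_b 1] solves the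
    same equation; its restriction to [{a, b}] is [(v_a - v_b) e_a] and is mapped
    by the Schur complement to [e_a - e_b], so that
    [C(a, b) (v_a - v_b) = 1]. *)

Section SubsetInclusion.
Variables (R : realType) (n : nat).
Implicit Types (M : 'M[R]_n) (B C : {set 'I_n}).

(** This $0/1$ matrix extends a vector on [B] by zero and its transpose restricts to [B], so block
    identities become products of matrices over ['I_n]. *)
Definition incl_mx B : 'M[R]_(n, #|B|) := \matrix_(i, k) (i == enum_val k)%:R.

Lemma tr_incl_mulE B m (M : 'M[R]_(n, m)) k j :
  ((incl_mx B)^T *m M) k j = M (enum_val k) j.
Proof.
rewrite !mxE (bigD1 (enum_val k)) //= !mxE eqxx mul1r big1 ?addr0 // => i ik.
by rewrite !mxE (negbTE ik) mul0r.
Qed.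

Lemma mul_inclE B m (M : 'M[R]_(m, n)) i k :
  (M *m incl_mx B) i k = M i (enum_val k).
Proof.
by rewrite -[M]trmxK -[incl_mx B]trmxK -trmx_mul mxE tr_incl_mulE !mxE.
Qed.

Lemma set_submxE M B C :
  set_submx M B C = (incl_mx B)^T *m M *m incl_mx C.
Proof. by apply/matrixP => k l; rewrite mxE mul_inclE tr_incl_mulE. Qed.

Lemma tr_incl_mxK B : (incl_mx B)^T *m incl_mx B = 1%:M.
Proof.
by apply/matrixP => k l; rewrite tr_incl_mulE !mxE (inj_eq enum_val_inj).
Qed.

Lemma incl_mx_notin B m (M : 'M[R]_(#|B|, m)) i j :
  i \notin B -> (incl_mx B *m M) i j = 0.
Proof.
move=> iB; rewrite mxE big1 // => k _; rewrite mxE.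
case: eqP => [ik|]; last by rewrite mul0r.
by rewrite ik enum_valP in iB.
Qed.

Lemma incl_mx_partition B :
  incl_mx B *m (incl_mx B)^T + incl_mx (~: B) *m (incl_mx (~: B))^T = 1%:M.
Proof.
have inclE C i j : (incl_mx C *m (incl_mx C)^T) i j = ((i \in C) && (i == j))%:R.
  case: (boolP (i \in C)) => iC /=; last exact: incl_mx_notin.
  have [k ->] : exists k : 'I_#|C|, i = enum_val k.
    by exists (enum_rank_in iC i); rewrite enum_rankK_in.
  by rewrite -tr_incl_mulE mulmxA tr_incl_mxK mul1mx !mxE eq_sym.
apply/matrixP => i j; rewrite mxE !inclE inE !mxE.
by case: (i \in B); rewrite /= ?addr0 ?add0r.
Qed.

(** Block elimination: with [w] split into parts on [B] and [~: B], the vanishing rows express the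
    block $M[B^c,B]$ on the first part as $-M[B^c,B^c]$ on the second, which cancels the inverse. *)
Lemma schur_mul M B (w : 'cV[R]_n) :
    set_submx M (~: B) (~: B) \in unitmx ->
    (incl_mx (~: B))^T *m (M *m w) = 0 ->
  schur M B *m ((incl_mx B)^T *m w) = (incl_mx B)^T *m (M *m w).
Proof.
rewrite /schur !set_submxE; have := incl_mx_partition B.
set P := incl_mx B; set Q := incl_mx (~: B); set D := Q^T *m M *m Q.
move=> PQ uD Mw0.
have Pw : P *m (P^T *m w) = w - Q *m (Q^T *m w).
  by rewrite -[X in X - _]mul1mx -PQ mulmxDl !mulmxA addrK.
rewrite mulmxBl -!mulmxA Pw !mulmxBr Mw0 !mulmx0 sub0r opprK.
rewrite (_ : Q^T *m (M *m (Q *m (Q^T *m w))) = D *m (Q^T *m w)); last first.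
  by rewrite !mulmxA.
by rewrite mulKmx // subrK.
Qed.

End SubsetInclusion.

Section Laplacian.
Variables (R : realType) (n : nat) (G : wdigraph R n).
Local Notation L := (laplacian G).

Lemma laplacian_mulE (u : 'cV[R]_n) i :
  (L *m u) i 0 = \sum_j adj G i j * (u i 0 - u j 0).
Proof.
rewrite mulmxBl mul_diag_mx !mxE mulr_suml -sumrB.
by apply: eq_bigr => j _; rewrite mulrBr.
Qed.

Lemma laplacian_mul_const (c : R) : L *m const_mx c = 0 :> 'cV_n.
Proof.
apply/colP => i; rewrite laplacian_mulE [RHS]mxE big1 // => j _.
by rewrite !mxE subrr mulr0.
Qed.

Hypothesis hwb : weight_balanced G.

Lemma const_mul_laplacian (c : R) : const_mx c *m L = 0 :> 'rV_n.
Proof.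
apply/rowP => j; rewrite mulmxBr mul_mx_diag !mxE hwb mulr_sumr -sumrB.
by rewrite big1 // => i _; rewrite !mxE subrr.
Qed.

(** Expanding by rows gives $u_i^2 - u_i u_j$; balance allows $u_j^2$ in place of $u_i^2$, and the
    two expansions add up to the square. *)
Lemma laplacian_form (u : 'cV[R]_n) :
  (u^T *m L *m u) 0 0 *+ 2 = \sum_i \sum_j adj G i j * (u i 0 - u j 0) ^+ 2.
Proof.
have rows : (u^T *m L *m u) 0 0 =
    \sum_i \sum_j adj G i j * (u i 0 ^+ 2 - u i 0 * u j 0).
  rewrite -mulmxA mxE; apply: eq_bigr => i _.
  rewrite laplacian_mulE mxE mulr_sumr; apply: eq_bigr => j _.
  by rewrite mulrCA mulrBr expr2.
have swap : \sum_i \sum_j adj G i j * u i 0 ^+ 2 =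
    \sum_i \sum_j adj G i j * u j 0 ^+ 2.
  rewrite [RHS]exchange_big /=; apply: eq_bigr => i _.
  by rewrite -!mulr_suml hwb.
have cols : (u^T *m L *m u) 0 0 =
    \sum_i \sum_j adj G i j * (u j 0 ^+ 2 - u i 0 * u j 0).
  rewrite rows; under eq_bigr => i _ do
    (under eq_bigr => j _ do rewrite mulrBr; rewrite sumrB).
  rewrite sumrB swap -sumrB; apply: eq_bigr => i _; rewrite -sumrB.
  by apply: eq_bigr => j _; rewrite mulrBr.
rewrite mulr2n {1}rows cols -big_split; apply: eq_bigr => i _ /=.
rewrite -big_split; apply: eq_bigr => j _ /=.
ring.
Qed.

Hypothesis hsc : strongly_connected G.

(** A vanishing sum of nonnegative terms forces equality of [u] across each edge, hence along a
    directed path from [i] to [j]. *)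
Lemma laplacian_form_eq0 (u : 'cV[R]_n) i j :
  (u^T *m L *m u) 0 0 = 0 -> u i 0 = u j 0.
Proof.
move=> u0; have := laplacian_form u; rewrite u0 mul0rn => /esym sum0.
have term_ge0 k l : 0 <= adj G k l * (u k 0 - u l 0) ^+ 2.
  by rewrite mulr_ge0 ?adj_ge0 ?sqr_ge0.
have edge_eq k l : edge G k l -> u k 0 = u l 0.
  case/andP=> _ Akl.
  have row0 : \sum_l adj G k l * (u k 0 - u l 0) ^+ 2 = 0.
    by apply: (psumr_eq0P _ sum0) => // i' _; apply: sumr_ge0.
  have /eqP : adj G k l * (u k 0 - u l 0) ^+ 2 = 0 by apply: (psumr_eq0P _ row0).
  by rewrite mulf_eq0 (gt_eqF Akl) sqrf_eq0 subr_eq0 => /eqP.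
have [->//|/hsc/connectP[p]] := eqVneq i j.
elim: p i => [i _ ->//|k p IHp i /= /andP[/edge_eq -> pk] jl].
exact: IHp.
Qed.

(** A kernel vector, extended by zero outside [B], has zero form, so it is constant, with value $0$
    at [a]. *)
Lemma laplacian_submx_unit (B : {set 'I_n}) (a : 'I_n) :
  a \notin B -> set_submx L B B \in unitmx.
Proof.
move=> aB; rewrite set_submxE -unitmx_tr -row_free_unit.
apply/inj_row_free => v /(congr1 trmx).
rewrite trmx_mul trmxK trmx0 => v0.
pose u := incl_mx R B *m v^T.
have form0 : (u^T *m L *m u) 0 0 = 0.
  have -> : u^T *m L *m u = v *m ((incl_mx R B)^T *m L *m incl_mx R B *m v^T).
    by rewrite trmx_mul trmxK !mulmxA.
  by rewrite v0 mulmx0 mxE.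
have u0 : u = 0.
  by apply/colP => i; rewrite (laplacian_form_eq0 i a form0) incl_mx_notin ?mxE.
by apply: trmx_inj; rewrite -[LHS]mul1mx -(tr_incl_mxK R B) -mulmxA -/u u0 mulmx0 trmx0.
Qed.

(* [y] is the component of [x] along the kernel of [L^T], which consists of
   constant vectors, while its entries have the same sum as those of [x]. *)
Lemma laplacian_pinvK (x : 'cV[R]_n) :
  const_mx 1 *m x = 0 :> 'M_1 -> L *m (pinv L *m x) = x.
Proof.
move=> x0; have [LXL _ trLX _] := pinvP L.
pose y := x - L *m (pinv L *m x).
have yL : y^T *m L = 0.
  (* Symmetry of $L L^\dagger$ gives $y^\top = x^\top (1 - L L^\dagger)$, and $L L^\dagger L =
     L$. *)
  rewrite /y mulmxA -[X in X - _]mul1mx -mulmxBl trmx_mul.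
  rewrite [(_ - _)^T]linearB /= trLX trmx1.
  by rewrite -mulmxA mulmxBl LXL mul1mx subrr mulmx0.
have y_const i j : y i 0 = y j 0.
  by apply: laplacian_form_eq0; rewrite yL mul0mx mxE.
have : const_mx 1 *m y = 0 :> 'M_1.
  by rewrite mulmxBr x0 (mulmxA (const_mx 1)) const_mul_laplacian mul0mx subrr.
move=> /matrixP/(_ 0 0); rewrite !mxE => sum_y.
apply/esym/eqP; rewrite -subr_eq0 -/y; apply/eqP/colP => i.
move: sum_y; under eq_bigr => j _ do rewrite mxE mul1r (y_const j i).
rewrite sumr_const card_ord => /eqP.
(* The index [i] itself shows that [n] is nonzero. *)
by rewrite mulrn_eq0 (gtn_eqF (leq_ltn_trans _ (ltn_ord i))) // [RHS]mxE => /eqP.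
Qed.

Lemma eff_conductance_potential (a b : 'I_n) (v : 'cV[R]_n) :
    a != b -> L *m v = basis_vec R a - basis_vec R b ->
  eff_conductance G a b * (v a 0 - v b 0) = 1.
Proof.
move=> ab Lv; rewrite /eff_conductance; set ia := enum_rank_in _ _.
have iaE : enum_val ia = a by rewrite enum_rankK_in ?set21.
pose w : 'cV[R]_n := v - const_mx (v b 0).
have Lw : L *m w = basis_vec R a - basis_vec R b.
  by rewrite mulmxBr laplacian_mul_const subr0.
have Lw0 : (incl_mx R (~: [set a; b]))^T *m (L *m w) = 0.
  apply/colP => k; rewrite tr_incl_mulE Lw !mxE !eqxx !andbT.
  have := enum_valP k; rewrite !inE negb_or => /andP[/negbTE -> /negbTE ->].
  by rewrite subrr.
have unitS : set_submx L (~: [set a; b]) (~: [set a; b]) \in unitmx.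
  by apply: (@laplacian_submx_unit _ a); rewrite !inE eqxx.
have /colP/(_ ia) := schur_mul unitS Lw0.
rewrite tr_incl_mulE iaE Lw mxE (bigD1 ia) //= tr_incl_mulE iaE big1 ?addr0.
  by rewrite !mxE !eqxx (negbTE ab) subr0.
(* The other index of the pair is that of [b], where the shift makes [w] vanish. *)
move=> k k_ia; rewrite tr_incl_mulE.
suff -> : enum_val k = b by rewrite !mxE subrr mulr0.
have := enum_valP k; rewrite !inE => /orP[/eqP ka|/eqP//].
by case/eqP: k_ia; apply: enum_val_inj; rewrite ka iaE.
Qed.

End Laplacian.

(** A $1 \times 1$ matrix is its own transpose, so [M] and [M^T] have the same quadratic form. *)
Lemma form_sym_part (R : realType) (n : nat) (M : 'M[R]_n) (x : 'cV[R]_n) :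
  x^T *m sym_part M *m x = x^T *m M *m x.
Proof.
have trM : x^T *m M^T *m x = x^T *m M *m x.
  have -> : x^T *m M^T *m x = (x^T *m M *m x)^T by rewrite !trmx_mul trmxK mulmxA.
  by apply/matrixP => i j; rewrite [LHS]mxE !ord1.
rewrite /sym_part -scalemxAr -scalemxAl mulmxDr mulmxDl trM -mulr2n -scaler_nat.
by rewrite scalerA mulVf ?scale1r // pnatr_eq0.
Qed.

Theorem theorem4p9 (R : realType) (n : nat) (hn : (2 <= n)%N)
    (G : wdigraph R n) (hsc : strongly_connected G) (hwb : weight_balanced G)
    (a b : 'I_n) (hab : a != b) :
  let x := basis_vec R a - basis_vec R b in
  eff_resistance G a b = (x^T *m pinv (laplacian G) *m x) 0 0 /\
  (x^T *m pinv (laplacian G) *m x) 0 0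
    = (x^T *m sym_part (pinv (laplacian G)) *m x) 0 0.
Proof.
move=> x; split; last by rewrite form_sym_part.
set v := pinv (laplacian G) *m x.
have basisE c m (M : 'M[R]_(n, m)) : (basis_vec R c)^T *m M = row c M.
  by rewrite trmx_delta rowE.
have sum_x : const_mx 1 *m x = 0 :> 'M_1.
  by rewrite mulmxBr /basis_vec -!colE; apply/matrixP => i j; rewrite !mxE subrr.
have Lv : laplacian G *m v = x by apply: laplacian_pinvK.
have xv : (x^T *m pinv (laplacian G) *m x) 0 0 = v a 0 - v b 0.
  by rewrite -mulmxA -/v linearB mulmxBl !basisE !mxE.
have Cv := eff_conductance_potential hwb hsc hab Lv.
(* The product equal to $1$ already excludes a zero conductance, so the reciprocal is a genuine
   inverse. *)
have C0 : eff_conductance G a b != 0.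
  by apply: contra_eq_neq Cv => ->; rewrite mul0r eq_sym oner_eq0.
by rewrite xv /eff_resistance div1r; apply: (mulfI C0); rewrite mulfV.
Qed.
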